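(* Let $(Z^{\bullet,j},d^{\bullet,j})$ and $S^{i,j}$ (with closed ranges) be as described in the context, with twisted complex $(Y^\bullet,d_V^\bullet)$, BGG complex $(\Upsilon^\bullet,\mathscr{D}^\bullet)$ and maps $A^i$, $B^i$. Let $P_V^i:Y^i\to Y^{i-1}$ be linear operators satisfying a homotopy relation $d_V^{i-1}P_V^i+P_V^{i+1}d_V^i=I-L_V^i$ for all $i$, with $d_VL_V=L_Vd_V=0$ (i.e. $d_V^iL_V^i=0$ and $L_V^{i+1}d_V^i=0$ for all $i$). Put $\mathscr{P}^i:=B^{i-1}P_V^iA^i:\Upsilon^i\to\Upsilon^{i-1}$. Then $\mathscr{P}^\bullet$ satisfies a homotopy relation of the form $$\mathscr{D}^{i-1}\mathscr{P}^i+\mathscr{P}^{i+1}\mathscr{D}^i=I-\mathscr{L}^i\quad\text{for all } i,\qquad\text{with } \mathscr{L}\mathscr{D}=\mathscr{D}\mathscr{L}=0 .$$ Moreover, if $L_V^2=L_V$, then also $\mathscr{L}^2=\mathscr{L}$. Finally, if $P_V$ has the complex property ($P_V^{i-1}P_V^i=0$ for all $i$), then $L_V^2=L_V$, and $\mathscr{P}^\bullet$ can be modified in such a way that, in addition to all the preceding properties (homotopy relation $\mathscr{D}\mathscr{P}+\mathscr{P}\mathscr{D}=I-\mathscr{L}$ with $\mathscr{L}\mathscr{D}=\mathscr{D}\mathscr{L}=0$ and $\mathscr{L}^2=\mathscr{L}$), it has the complex property $\mathscr{P}^{i-1}\mathscr{P}^i=0$ for all $i$, too.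
   Context: For $0\le i\le n$, $0\le j\le N$ let $Z^{i,j}$ be Hilbert spaces; spaces with indices out of range, and operators from or to them, are zero. Let $d^{i,j}:Z^{i,j}\to Z^{i+1,j}$ be bounded linear operators with $d^{i+1,j}d^{i,j}=0$, and let $S^{i,j}:Z^{i,j}\to Z^{i+1,j-1}$ be bounded linear operators with closed range such that $d^{i+1,j-1}S^{i,j}=-S^{i+1,j}d^{i,j}$ and $S^{i+1,j-1}S^{i,j}=0$. Put $Y^i=Z^{i,0}\times\cdots\times Z^{i,N}$ (Hilbert space product); $d^i:Y^i\to Y^{i+1}$ acts componentwise and $S^i:Y^i\to Y^{i+1}$ is $S^i(u_0,\dots,u_N)=(S^{i,1}u_1,\dots,S^{i,N}u_N,0)$. The twisted complex is $(Y^\bullet,d_V^\bullet)$ with $d_V^i=d^i-S^i$. BGG complex: $\Upsilon^i:=\ker(S^i)\cap\operatorname{ran}(S^{i-1})^\perp\subset Y^i$, with orthogonal projection $\Pi_{\Upsilon^i}:Y^i\to\Upsilon^i$; $T^i:=(S^{i-1}|_{\ker(S^{i-1})^\perp})^{-1}\circ\Pi_{\operatorname{ran}(S^{i-1})}:Y^i\to Y^{i-1}$, where $\Pi_{\operatorname{ran}(S^{i-1})}$ is the orthogonal projection; $G^i:=-\sum_{k\ge0}(T^id^{i-1})^kT^i:Y^i\to Y^{i-1}$ (a finite sum); $A^i:=(I-G^{i+1}d_V^i)|_{\Upsilon^i}:\Upsilon^i\to Y^i$; $B^i:=\Pi_{\Upsilon^i}(I-d_V^{i-1}G^i):Y^i\to\Upsilon^i$;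 $\mathscr{D}^i:=\Pi_{\Upsilon^{i+1}}d_V^iA^i:\Upsilon^i\to\Upsilon^{i+1}$. The BGG complex is $(\Upsilon^\bullet,\mathscr{D}^\bullet)$. *)

(* Defs.v *)
From HB Require Import structures.
From mathcomp Require Import all_boot all_order all_algebra.
From mathcomp Require Import all_classical all_reals all_analysis.
From mathcomp Require Import complex.

Set Implicit Arguments.
Unset Strict Implicit.
Unset Printing Implicit Defensive.

Import Order.TTheory GRing.Theory Num.Theory.
Import numFieldNormedType.Exports.

Local Open Scope classical_set_scope.
Local Open Scope ring_scope.

(* Hilbert spaces are taken over the real or over the complex numbers. *)
Variant scalar_kind := RealScalars | ComplexScalars.

Definition scalars (R : realType) (c : scalar_kind) : numFieldType :=
  match c with RealScalars => R | ComplexScalars => R[i] end.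

Definition scalar_conj (R : realType) (c : scalar_kind) :
    {rmorphism scalars R c -> scalars R c} :=
  match c return {rmorphism scalars R c -> scalars R c} with
  | RealScalars => idfun
  | ComplexScalars => conjc
  end.

HB.mixin Record hasInner (K : numFieldType) (theta : {rmorphism K -> K}) V
    & GRing.Lmodule K V := {
  inner : {dot V for theta}
}.

#[short(type="innerProductType")]
HB.structure Definition InnerProduct (K : numFieldType) (theta : {rmorphism K -> K}) :=
  {V of GRing.Lmodule K V & hasInner K theta V}.

HB.mixin Record InnerProduct_isHilbert (K : numFieldType) (theta : {rmorphism K -> K}) V
    & InnerProduct K theta V & CompleteNormedModule K V := {
  sqr_norm_inner : forall x : V, `|x| ^+ 2 = (inner : {dot V for theta}) x x
}.

#[short(type="hilbertType")]
HB.structure Definition Hilbert (K : numFieldType) (theta : {rmorphism K -> K}) :=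
  {V of InnerProduct K theta V & CompleteNormedModule K V
      & InnerProduct_isHilbert K theta V}.

Definition ip (K : numFieldType) (theta : {rmorphism K -> K})
  (V : innerProductType theta) (x y : V) : K := (inner : {dot V for theta}) x y.

Definition bounded_op (K : numFieldType) (V W : normedModType K)
  (f : V -> W) : Prop := exists M : K, forall x, `|f x| <= M * `|x|.

Section InnerProductSpaces.
Context {K : numFieldType} {theta : {rmorphism K -> K}}.

Definition orthocomp (V : innerProductType theta) (W : set V) : set V :=
  [set x | forall w, W w -> ip x w = 0].

Definition orthproj (V : innerProductType theta) (W : set V) (x : V) : V :=
  xget 0 [set y | W y /\ orthocomp W (x - y)].

Lemma orthocomp_submod (V : innerProductType theta) (W : set V) (a : K) (x y : V) :
  orthocomp W x -> orthocomp W y -> orthocomp W (a *: x + y).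
Proof.
move=> Wx Wy w Ww; rewrite /ip linearPl /=.
by have := Wx w Ww; have := Wy w Ww; rewrite /ip => -> ->; rewrite mulr0 addr0.
Qed.

Lemma orthocomp0 (V : innerProductType theta) (W : set V) : orthocomp W 0.
Proof. by move=> w _; rewrite /ip linear0l. Qed.

Definition hprod (I : finType) (Z : I -> innerProductType theta) : Type :=
  forall j, Z j.

Section Product.
Context (I : finType) (Z : I -> innerProductType theta).
Implicit Types u v w : hprod Z.

HB.instance Definition _ := gen_eqMixin (hprod Z).
HB.instance Definition _ := gen_choiceMixin (hprod Z).

Definition hprod_zero : hprod Z := fun j => 0.
Definition hprod_opp u : hprod Z := fun j => - u j.
Definition hprod_add u v : hprod Z := fun j => u j + v j.
Definition hprod_scale (a : K) u : hprod Z := fun j => a *: u j.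

Fact hprod_addA : associative hprod_add.
Proof. by move=> u v w; apply/functional_extensionality_dep => j; exact: addrA. Qed.
Fact hprod_addC : commutative hprod_add.
Proof. by move=> u v; apply/functional_extensionality_dep => j; exact: addrC. Qed.
Fact hprod_add0 : left_id hprod_zero hprod_add.
Proof. by move=> u; apply/functional_extensionality_dep => j; exact: add0r. Qed.
Fact hprod_addN : left_inverse hprod_zero hprod_opp hprod_add.
Proof. by move=> u; apply/functional_extensionality_dep => j; exact: addNr. Qed.

HB.instance Definition _ := GRing.isZmodule.Build (hprod Z)
  hprod_addA hprod_addC hprod_add0 hprod_addN.

Fact hprod_scaleA a b u : hprod_scale a (hprod_scale b u) = hprod_scale (a * b) u.
Proof. by apply/functional_extensionality_dep => j; exact: scalerA. Qed.
Fact hprod_scale1 : left_id 1 hprod_scale.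
Proof. by move=> u; apply/functional_extensionality_dep => j; exact: scale1r. Qed.
Fact hprod_scaleDr : right_distributive hprod_scale +%R.
Proof. by move=> a u v; apply/functional_extensionality_dep => j; exact: scalerDr. Qed.
Fact hprod_scaleDl u : {morph hprod_scale^~ u : a b / a + b}.
Proof. by move=> a b; apply/functional_extensionality_dep => j; exact: scalerDl. Qed.

HB.instance Definition _ := GRing.Zmodule_isLmodule.Build K (hprod Z)
  hprod_scaleA hprod_scale1 hprod_scaleDr hprod_scaleDl.

Definition hprod_ip u v : K := \sum_j ip (u j) (v j).

Fact hprod_ipBl v : zmod_morphism (hprod_ip^~ v).
Proof.
move=> u w; rewrite /hprod_ip -sumrB; apply: eq_bigr => j _.
by rewrite /ip -linearBl.
Qed.
Fact hprod_ipBr u : zmod_morphism (hprod_ip u).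
Proof.
move=> v w; rewrite /hprod_ip -sumrB; apply: eq_bigr => j _.
by rewrite /ip -linearBr.
Qed.
Fact hprod_ipZl v : scalable_for *%R (hprod_ip^~ v).
Proof.
move=> a u; rewrite /hprod_ip mulr_sumr; apply: eq_bigr => j _.
by rewrite /ip -linearZl_LR.
Qed.
Fact hprod_ipZr u : scalable_for (theta \; *%R) (hprod_ip u).
Proof.
move=> a v; rewrite /hprod_ip /= mulr_sumr; apply: eq_bigr => j _.
by rewrite /ip linearZ_LR.
Qed.
HB.instance Definition _ := isBilinear.Build K (hprod Z) (hprod Z) K
  ( *%R ) (theta \; *%R) hprod_ip hprod_ipBl hprod_ipBr hprod_ipZl hprod_ipZr.

Fact hprod_ip_herm u v : hprod_ip u v = (-1) ^+ false * theta (hprod_ip v u).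
Proof.
rewrite /hprod_ip expr0 mul1r rmorph_sum; apply: eq_bigr => j _.
by rewrite /ip hermC expr0 mul1r.
Qed.
HB.instance Definition _ := isHermitianSesquilinear.Build K (hprod Z)
  false theta hprod_ip hprod_ip_herm.

Fact hprod_ip_gt0 u : u != 0 -> 0 < hprod_ip u u.
Proof.
move=> u0; have [j uj0] : exists j, u j != 0.
  apply: contrapT => h; move/eqP: u0; apply.
  apply/functional_extensionality_dep => j; apply/eqP/negPn/negP => uj0.
  by apply: h; exists j.
rewrite /hprod_ip (bigD1 j)//= ltr_pwDl ?neq0_dnorm_gt0//.
apply: sumr_ge0 => k _; rewrite /ip.
by have [->|/neq0_dnorm_gt0/ltW//] := eqVneq (u k) 0; rewrite linear0l.
Qed.
HB.instance Definition _ := isDotProduct.Build K (hprod Z) hprod_ip hprod_ip_gt0.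

HB.instance Definition _ := hasInner.Build K theta (hprod Z) hprod_ip.
End Product.
End InnerProductSpaces.

(* For a cochain index i : nat, the operators of degree +1 are typed
   X i -> X i.+1 and those of degree -1 are typed X i.+1 -> X i, so that the
   operator written P^i on paper is P i.-1 here; P^0 has values in X^{-1} = 0. *)
Section Homotopy.
Context {K : numFieldType} (X : nat -> lmodType K).
Variables (D : forall i, X i -> X i.+1) (P : forall i, X i.+1 -> X i).

Definition prev_comp i : X i -> X i :=
  match i return X i -> X i with
  | 0%N => fun=> 0
  | k.+1 => fun u => D (P u)
  end.

Definition homotopy (L : forall i, X i -> X i) : Prop :=
  forall i u, prev_comp u + P (D u) = u - L i u.
End Homotopy.

Section TwistedBGG.
Context {K : numFieldType} {theta : {rmorphism K -> K}}.
Context {N : nat} {Z : nat -> nat -> hilbertType theta}.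
Variable d : forall i j, {linear Z i j -> Z i.+1 j}.
(* S i j is S^{i,j+1}; the operators S^{i,0} have a zero target. *)
Variable S : forall i j, {linear Z i j.+1 -> Z i.+1 j}.

(* The product inner product makes Y complete as well; only the inner product
   enters the definitions. *)
Definition twY i := @hprod K theta 'I_N.+1 (fun j => Z i j).
HB.instance Definition _ i := InnerProduct.on (twY i).

(* The component u_j, read as 0 when j > N. *)
Definition twcomp i (u : twY i) (j : nat) : Z i j :=
  match decP (@idP (j < N.+1)%N) with
  | left h => u (Ordinal h)
  | right _ => 0
  end.

Definition twd i (u : twY i) : twY i.+1 := fun j => d i j (u j).
Definition twS i (u : twY i) : twY i.+1 := fun j => S i j (twcomp u j.+1).
Definition twdV i (u : twY i) : twY i.+1 := twd u - twS u.

Fact twcompP i j (a : K) (u v : twY i) :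
  twcomp (a *: u + v) j = a *: twcomp u j + twcomp v j.
Proof. by rewrite /twcomp; case: decP => // _; rewrite scaler0 addr0. Qed.

Fact twd_linear i : linear (@twd i).
Proof.
by move=> a u v; apply/functional_extensionality_dep => j; exact: linearP.
Qed.
HB.instance Definition _ i :=
  GRing.isLinear.Build K (twY i) (twY i.+1) _ (@twd i) (@twd_linear i).

Fact twS_linear i : linear (@twS i).
Proof.
move=> a u v; apply/functional_extensionality_dep => j.
by rewrite /twS twcompP linearP.
Qed.
HB.instance Definition _ i :=
  GRing.isLinear.Build K (twY i) (twY i.+1) _ (@twS i) (@twS_linear i).

Definition kerS i : set (twY i) := [set u | twS u = 0].

Definition ran_prevS i : set (twY i) :=
  match i return set (twY i) with
  | 0%N => [set 0]
  | k.+1 => range (@twS k)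
  end.

Definition in_upsilon i : {pred twY i} :=
  mem (kerS (i := i) `&` orthocomp (ran_prevS (i := i)) : set (twY i)).

Fact in_upsilon_submod i : submod_closed (@in_upsilon i).
Proof.
split=> [|a u v].
  rewrite in_setE; split; first exact: linear0.
  exact: orthocomp0.
rewrite !in_setE => -[Su uR] [Sv vR]; split; last exact: orthocomp_submod.
by rewrite /kerS /= linearP /= Su Sv scaler0 addr0.
Qed.
HB.instance Definition _ i := GRing.isSubmodClosed.Build K (twY i)
  (@in_upsilon i) (@in_upsilon_submod i).

Definition upsilon i := {u : twY i | u \in @in_upsilon i}.
HB.instance Definition _ i := [isSub of upsilon i for @sval _ _].
HB.instance Definition _ i := [Choice of upsilon i by <:].
HB.instance Definition _ i := [SubChoice_isSubLmodule of upsilon i by <:].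

Definition upsilon_proj i (u : twY i) : upsilon i :=
  insubd 0 (orthproj (kerS (i := i) `&` orthocomp (ran_prevS (i := i))) u).

Definition bggT i (u : twY i.+1) : twY i :=
  'pinv_(fun=> 0) (orthocomp (kerS (i := i))) (@twS i)
    (orthproj (range (@twS i)) u).

(* A sum over the k whose term is nonzero: there are finitely many of them, as
   d preserves the index j and T raises it by one. *)
Definition bggG i (u : twY i.+1) : twY i :=
  - \sum_(k \in [set: nat]) iter k (@bggT i \o @twd i) (bggT u).

Definition bggA i (u : upsilon i) : twY i := val u - bggG (twdV (val u)).

Definition bggB i (u : twY i) : upsilon i :=
  upsilon_proj (u - prev_comp twdV bggG u).

Definition bggD i (u : upsilon i) : upsilon i.+1 := upsilon_proj (twdV (bggA u)).

Definition bggP (P : forall i, twY i.+1 -> twY i) i (u : upsilon i.+1) :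
  upsilon i := bggB (P i (bggA u)).
End TwistedBGG.

Arguments twY {K theta} N Z i.
Arguments twdV {K theta} N {Z} d S i u.
Arguments upsilon {K theta} N {Z} S i.
Arguments bggD {K theta} N {Z} d S i u.
Arguments bggP {K theta} N {Z} d S P i u.

(* Main.v *)
Require Import Defs.
From HB Require Import structures.
From mathcomp Require Import all_boot all_order all_algebra.
From mathcomp Require Import all_classical all_reals all_analysis.
From mathcomp Require Import complex ring.
Import Order.TTheory GRing.Theory Num.Theory.
Import numFieldNormedType.Exports.
Set Implicit Arguments.
Unset Strict Implicit.
Unset Printing Implicit Defensive.
Local Open Scope classical_set_scope.
Local Open Scope ring_scope.

(* With T the pseudo-inverse of S one has Pi = 1 - S T - T S on Y for the
   projection onto Upsilon, T T = 0, T S T = T, and G = - (1 - T d)^-1 T satisfies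
   G d_V G = G and G G = 0. Hence Q = 1 - d_V G - G d_V is an idempotent cochain
   map, Q T = T Q = 0 gives Q Pi Q = Q, and since A = Q on Upsilon and B = Pi Q,
   one finds B A = 1 and A B = Q. So A and B are mutually inverse up to homotopy,
   the homotopy relation is transferred with L = B L_V A, and L_V A B L_V = L_V L_V.
   The complex property is obtained by replacing P with P D P. *)

(** * Orthogonality and projections in inner product spaces *)

Section InnerProductTheory.
Context {K : numFieldType} {theta : {rmorphism K -> K}}.
Context {V : innerProductType theta}.
Implicit Types (x y z : V) (a : K) (W : set V).

Lemma ipDl x y z : ip (x + y) z = ip x z + ip y z.
Proof. exact: linearDl. Qed.

Lemma ipBl x y z : ip (x - y) z = ip x z - ip y z.
Proof. exact: linearBl. Qed.

Lemma ipZl a x y : ip (a *: x) y = a * ip x y.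
Proof. exact: linearZl_LR. Qed.

Lemma ipC x y : ip x y = theta (ip y x).
Proof. by rewrite /ip hermC expr0 mul1r. Qed.

Lemma ipDr x y z : ip x (y + z) = ip x y + ip x z.
Proof. exact: linearDr. Qed.

Lemma ipBr x y z : ip x (y - z) = ip x y - ip x z.
Proof. exact: linearBr. Qed.

Lemma ipZr a x y : ip x (a *: y) = theta a * ip x y.
Proof. by rewrite ipC ipZl rmorphM /= -ipC. Qed.

Lemma ip_gt0 x : x != 0 -> 0 < ip x x.
Proof. exact: neq0_dnorm_gt0. Qed.

Lemma ip_eq0 x : ip x x = 0 -> x = 0.
Proof.
by move=> x0; apply/eqP/negPn/negP => /ip_gt0; rewrite x0 ltxx.
Qed.

Lemma ip_eq0C x y : ip x y = 0 -> ip y x = 0.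
Proof. by move=> xy0; rewrite ipC xy0 rmorph0. Qed.

(** [theta] is an abstract ring morphism, so positivity is read off from [ip (a *: x) (a *: x)];
    this is what the nonzero vector [x] provides. *)
Lemma mul_theta_gt0 x a : a != 0 -> x != 0 -> 0 < a * theta a.
Proof.
move=> a0 x0; rewrite -(pmulr_lgt0 _ (ip_gt0 x0)) -mulrA -ipZr -ipZl.
by rewrite ip_gt0// scaler_eq0 negb_or a0.
Qed.

Definition submodule W := W 0 /\ forall a x y, W x -> W y -> W (a *: x + y).

Lemma submoduleB W x y : submodule W -> W x -> W y -> W (x - y).
Proof. by move=> [_ Wl] Wx Wy; rewrite addrC -scaleN1r; exact: Wl. Qed.

Lemma submodule_orthocomp W : submodule (orthocomp W).
Proof.
split; first exact: orthocomp0.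
by move=> a x y; exact: orthocomp_submod.
Qed.

Lemma submoduleI W1 W2 : submodule W1 -> submodule W2 -> submodule (W1 `&` W2).
Proof.
move=> [W10 W1l] [W20 W2l]; split=> // a x y [? ?] [? ?].
by split; [exact: W1l | exact: W2l].
Qed.

(** Isolated as a property because [twY] carries no norm: existence of projections is proved by
    completeness on each factor and then carried over to the product. *)
Definition projectable W := forall x, exists2 y, W y & orthocomp W (x - y).

Lemma orthoproj_unique W x y z : submodule W ->
  W y -> orthocomp W (x - y) -> W z -> orthocomp W (x - z) -> y = z.
Proof.
move=> sW Wy oy Wz oz; apply/eqP; rewrite -subr_eq0; apply/eqP/ip_eq0.
have Wyz := submoduleB sW Wy Wz.
have /(_ _ Wyz) := submoduleB (submodule_orthocomp W) oz oy.
by rewrite (_ : x - z - (x - y) = y - z)// opprB addrC addrA subrK.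
Qed.

Lemma orthprojP W x :
  projectable W -> W (orthproj W x) /\ orthocomp W (x - orthproj W x).
Proof.
move=> /(_ x)[y Wy oy].
by apply: (@xgetPex _ 0 [set y | W y /\ orthocomp W (x - y)]); exists y.
Qed.

Lemma orthprojE W x y : submodule W ->
  W y -> orthocomp W (x - y) -> orthproj W x = y.
Proof.
move=> sW Wy oy; have [Wp op] : W (orthproj W x) /\ orthocomp W (x - orthproj W x).
  by apply: (@xgetPex _ 0 [set y | W y /\ orthocomp W (x - y)]); exists y.
exact: orthoproj_unique op Wy oy.
Qed.

(* If <z, w> = c <> 0 then z - (c / <w, w>) w is shorter than z. *)
Lemma minimal_orthogonal z w :
  (forall a, ip z z <= ip (z - a *: w) (z - a *: w)) -> ip z w = 0.
Proof.
move=> zmin; apply/eqP/negPn/negP => c0.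
have w0 : w != 0 by apply: contraNneq c0 => ->; rewrite /ip linear0r.
have q0 := ip_gt0 w0.
pose a := ip z w / ip w w.
have aE : theta a = ip w z / ip w w.
  by rewrite rmorphM fmorphV /= -(ipC w z) -(ipC w w).
have := zmin a; rewrite ipBl !ipBr !ipZr !ipZl aE.
(* [a *: w] is the projection of [z] onto the line of [w], hence orthogonal to [z - a *: w]; the
   terms with [a *: w] in the first slot cancel. *)
rewrite [X in _ - X](_ : _ = 0) ?subr0; last first.
  by rewrite mulrCA divfK ?gt_eqF// subrr.
suff p0 : 0 < ip w z / ip w w * ip z w by rewrite lerDl oppr_ge0 lt_geF.
by rewrite mulrAC divr_gt0// mulrC (ipC w z) (mul_theta_gt0 c0 w0).
Qed.

End InnerProductTheory.

(* Stated for sets of nonnegative elements because in the complex case the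
   norms live in R[i], which is only partially ordered. *)
Definition has_nneg_inf (K : numFieldType) := forall A : set K, A !=set0 ->
  (forall a, A a -> 0 <= a) ->
  exists m, [/\ 0 <= m, forall a, A a -> m <= a &
    forall e, 0 < e -> exists2 a, A a & a < m + e].

Lemma realType_nneg_inf (R : realType) : has_nneg_inf R.
Proof.
move=> A A0 Age0.
have Alb : has_lbound A by exists 0 => a /Age0.
exists (inf A); split.
- exact: lb_le_inf.
- by move=> a; exact: ge_inf.
- by move=> e e0; have [a Aa] := inf_adherent e0 (conj A0 Alb); exists a.
Qed.

(** A nonnegative complex number has zero imaginary part, so the infimum is taken among real parts
    and embedded back. *)
Lemma complex_nneg_inf (R : realType) : has_nneg_inf R[i].
Proof.
move=> A [a0 Aa0] Age0.
have AE a : A a -> a = (complex.Re a)%:C%C.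
  by case: a => x y /Age0; rewrite lecE /= => /andP[/eqP-> _].
have [||m [m0 ml mA]] := @realType_nneg_inf R [set x | A x%:C%C].
- by exists (complex.Re a0); rewrite /= -AE.
- by move=> x /Age0; rewrite -(lecR 0).
exists m%:C%C; split; first by rewrite -(lecR 0) in m0.
- by move=> a Aa; rewrite (AE _ Aa) lecR ml //= -AE.
- move=> e e0; have eE : e = (complex.Re e)%:C%C.
    by case: (e) e0 => x y; rewrite ltcE /= => /andP[/eqP-> _].
  have [|x Ax xm] := mA (complex.Re e); first by rewrite eE (ltcR 0) in e0.
  by exists x%:C%C => //; rewrite eE -[ltRHS]rmorphD /= ltcR.
Qed.

Lemma scalars_nneg_inf (R : realType) (c : scalar_kind) :
  has_nneg_inf (scalars R c).
Proof. by case: c; [exact: realType_nneg_inf | exact: complex_nneg_inf]. Qed.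

(** * The projection theorem in a Hilbert space *)

Section ProjectionTheorem.
Context {K : numFieldType} {theta : {rmorphism K -> K}} {V : hilbertType theta}.
Implicit Types (x y z : V) (W : set V).

Lemma parallelogram x y :
  `|x - y| ^+ 2 = 2 * `|x| ^+ 2 + 2 * `|y| ^+ 2 - `|x + y| ^+ 2.
Proof.
have E (u : V) : `|u| ^+ 2 = ip u u by exact: sqr_norm_inner.
by rewrite !E ipBl !ipBr ipDl !ipDr; ring.
Qed.

(* The nearly distance-minimizing vectors of W form a Cauchy filter by the
   parallelogram identity. *)
Lemma closed_projectable W : has_nneg_inf K -> submodule W -> closed W ->
  projectable W.
Proof.
move=> Kinf sW cW x; have [W0 Wl] := sW.
have [||m [m0 ml mW]] := Kinf [set `|x - w| | w in W].
- by exists `|x - 0|, 0.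
- by move=> _ [w _ <-].
pose near_min e := [set w | W w /\ `|x - w| < m + e].
pose F := filter_from [set e : K | 0 < e] near_min.
have PF : ProperFilter F.
  apply: filter_from_proper; last first.
    by move=> e /mW[_ [w Ww <-]] lt; exists w.
  apply: filter_from_filter; first by exists 1 => /=.
  (* A positive number below both [e1] and [e2], obtained without comparing them. *)
  move=> e1 e2 /= e10 e20; exists (e1 * e2 / (e1 + e2)) => /=.
    by rewrite divr_gt0 ?mulr_gt0 ?addr_gt0.
  have lt1 : e1 * e2 / (e1 + e2) <= e1.
    by rewrite -mulrA ler_piMr 1?ltW// ltr_pdivrMr ?addr_gt0// mul1r ltrDr.
  have lt2 : e1 * e2 / (e1 + e2) <= e2.
    by rewrite mulrAC ler_piMl 1?ltW// ltr_pdivrMr ?addr_gt0// mul1r ltrDl.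
  move=> w [Ww lt]; split; split=> //; apply: (lt_le_trans lt).
    by rewrite lerD2l.
  by rewrite lerD2l.
(* The midpoint of [w] and [w'] lies in [W], at distance at least [m] from [x], so the parallelogram
   identity bounds the left side by 4 (m + e)^2 - 4 m^2 = 8 m e + 4 e^2, and e^2 <= e. *)
have near_close e w w' : 0 < e -> e <= 1 -> near_min e w -> near_min e w' ->
    `|w' - w| ^+ 2 <= (8 * m + 4) * e.
  move=> e0 e1 [Ww lt] [Ww' lt'].
  have := parallelogram (x - w) (x - w').
  have -> : x - w - (x - w') = w' - w by rewrite opprB addrC addrA subrK.
  move=> ->.
  have -> : x - w + (x - w') = 2 *: (x - 2^-1 *: (w + w')).
    by rewrite scalerBr scalerA divff// scale1r scaler_nat mulr2n addrACA -opprD.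
  rewrite normrZ exprMn normr_nat.
  have ml2 : m <= `|x - 2^-1 *: (w + w')|.
    apply: ml; exists (2^-1 *: (w + w')) => //.
    rewrite -[_ *: _]addr0; apply: (Wl _ _ _ _ W0).
    by rewrite -[w]scale1r; exact: Wl.
  have sq a : 0 <= a -> a < m + e -> a ^+ 2 <= (m + e) ^+ 2.
    by move=> a0 /ltW am; rewrite lerXn2r// nnegrE addr_ge0 ?(ltW e0).
  have h1 := sq _ (normr_ge0 _) lt.
  have h2 := sq _ (normr_ge0 _) lt'.
  have h3 : m ^+ 2 <= `|x - 2^-1 *: (w + w')| ^+ 2.
    by rewrite lerXn2r// nnegrE.
  have ee : e ^+ 2 <= e by rewrite expr2 ler_piMl// ltW.
  apply: (@le_trans _ _ (2 * (m + e) ^+ 2 + 2 * (m + e) ^+ 2 - 2 ^+ 2 * m ^+ 2)).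
    by rewrite lerB ?lerD ?ler_pM2l ?exprn_gt0.
  rewrite (_ : _ - _ = (8 * m) * e + 4 * e ^+ 2); last by ring.
  by rewrite [leRHS]mulrDl lerD2l ler_pM2l.
have Fc : cvg F.
  apply/cauchy_cvgP/cauchy_exP => r r0.
  pose q := 8 * m + 4.
  have q0 : 0 < q by rewrite ltr_wpDl ?mulr_ge0.
  have qr0 : 0 < q + r ^+ 2 by rewrite addr_gt0 ?exprn_gt0.
  (* This choice gives both [e <= 1] and [q * e < r ^+ 2], so that [near_min e] lies in a ball of
     radius [r]. *)
  pose e := r ^+ 2 / (q + r ^+ 2).
  have e0 : 0 < e by rewrite divr_gt0 ?exprn_gt0.
  have e1 : e <= 1 by rewrite ler_pdivrMr// mul1r lerDr ltW.
  have [_ [w Ww <-] wm] := mW _ e0.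
  exists w; exists e => // w' w'm.
  rewrite -ball_normE /ball_ /= -(@ltr_pXn2r _ 2)// ?nnegrE ?(ltW r0)//.
  have /le_lt_trans -> // := near_close e w' w e0 e1 w'm (conj Ww wm).
  by rewrite /e mulrCA gtr_pMr ?exprn_gt0// ltr_pdivrMr// mul1r ltrDl exprn_gt0.
have /cvg_ex[y Fy] := Fc.
have Wy : W y.
  apply: (@closed_cvg _ _ F _ id) Fy => //.
  by exists 1 => //= w [].
have ym : `|x - y| <= m.
  apply/ler_addgt0Pr => r r0.
  have r20 : 0 < r / 2 by rewrite divr_gt0.
  have Fr : F (near_min (r / 2)) by exists (r / 2).
  have Fb : F (ball y (r / 2)) by apply: Fy; exact: nbhsx_ballx.
  have [w [[Ww wm]]] := filter_ex (filterI Fr Fb).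
  rewrite -ball_normE /ball_ /= => yw.
  rewrite -(subrK w x) -addrA (le_trans (ler_normD _ _))// [r]splitr addrA.
  by rewrite lerD// ltW// distrC.
exists y => // w Ww; apply: minimal_orthogonal => a.
rewrite /ip -!sqr_norm_inner lerXn2r ?nnegrE// (le_trans ym)// -addrA -opprD.
apply: ml; exists (y + a *: w) => //.
by rewrite addrC; exact: Wl.
Qed.

End ProjectionTheorem.

(** Boundedness gives continuity, and the kernel is the preimage of the closed point 0. *)
Lemma closed_kernel (K : numFieldType) (V W : normedModType K)
  (f : {linear V -> W}) : bounded_op f -> closed [set x | f x = 0].
Proof.
move=> [M fM].
have fc : continuous f.
  apply: bounded_linear_continuous; apply/linear_boundedP.
  (* The bound [M] is an arbitrary scalar whose sign is known only once a nonzero [x] is at hand,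
     hence the absolute value. *)
  exists `|M|; split; first exact: normr_real.
  move=> r Mr x; have [->|x0] := eqVneq x 0.
    by rewrite linear0 !normr0 mulr0.
  have Mx : 0 <= M * `|x| := le_trans (normr_ge0 _) (fM x).
  rewrite pmulr_lge0 ?normr_gt0// in Mx; rewrite ger0_norm// in Mr.
  by rewrite (le_trans (fM x))// ler_wpM2r// ltW.
apply: (@preimage_closed _ _ f [set 0]) => [x _|]; first exact: fc.
exact: (accessible_closed_set1 (hausdorff_accessible (@norm_hausdorff _ W))).
Qed.

(** Bundles maps such as [bggT], whose linearity rests on the existence of projections and so comes
    with hypotheses. *)
Definition linear_of (K : numFieldType) (U V : lmodType K) (f : U -> V)
  (f_linear : linear f) : {linear U -> V} :=
  HB.pack f (GRing.isLinear.Build K U V *:%R f f_linear).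

(** * Pseudo-inverses of linear maps between inner product spaces *)

Section PseudoInverse.
Context {K : numFieldType} {theta : {rmorphism K -> K}}.
Context {V W : innerProductType theta} (f : {linear V -> W}).

(** The Moore-Penrose inverse; for [f] equal to [twS] it unfolds to [bggT]. *)
Definition pseudo_inverse (w : W) : V :=
  'pinv_(fun=> 0) (orthocomp [set v | f v = 0]) f (orthproj (range f) w).

Lemma submodule_ker : submodule [set v | f v = 0].
Proof.
split=> [|a x y /= fx fy]; first exact: linear0.
by rewrite linearP fx fy scaler0 addr0.
Qed.

Lemma submodule_range : submodule (range f).
Proof.
split=> [|a _ _ [x _ <-] [y _ <-]]; first by exists 0; rewrite ?linear0.
by exists (a *: x + y); rewrite ?linearP.
Qed.

Hypothesis ker_projectable : projectable [set v | f v = 0].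
Hypothesis range_projectable : projectable (range f).

(** [f] is injective on the orthogonal complement of its kernel: a difference there that [f] kills
    is orthogonal to itself. *)
Lemma pseudo_inverseE w v : orthocomp [set v | f v = 0] v ->
  orthocomp (range f) (w - f v) -> pseudo_inverse w = v.
Proof.
move=> ov ow; rewrite /pseudo_inverse (orthprojE submodule_range (y := f v))//.
  apply: pinvKV; last by rewrite inE.
  move=> x y; rewrite !inE => ox oy fxy; apply/eqP; rewrite -subr_eq0.
  apply/eqP/ip_eq0; apply: (submoduleB (submodule_orthocomp _) ox oy).
  by rewrite /= linearB fxy subrr.
Qed.

Lemma pseudo_inverseP w : orthocomp [set v | f v = 0] (pseudo_inverse w) /\
  orthocomp (range f) (w - f (pseudo_inverse w)).
Proof.
(* Project [w] onto the range as [f v], then remove from [v] its component in the kernel. *)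
have [_ [v _ <-] ow] := range_projectable w.
have [k /= fk ok] := ker_projectable v.
have fvk : f (v - k) = f v by rewrite linearB fk subr0.
by rewrite (@pseudo_inverseE w (v - k)) ?fvk.
Qed.

Lemma pseudo_inverse_linear : linear pseudo_inverse.
Proof.
move=> a x y; have [xp xr] := pseudo_inverseP x; have [yp yr] := pseudo_inverseP y.
apply: pseudo_inverseE; first exact: orthocomp_submod.
rewrite linearP opprD addrACA -scalerBr.
exact: orthocomp_submod.
Qed.

Lemma pseudo_inverseK w : pseudo_inverse (f (pseudo_inverse w)) = pseudo_inverse w.
Proof.
apply: pseudo_inverseE; first by have [] := pseudo_inverseP w.
by rewrite subrr; exact: orthocomp0.
Qed.

Lemma pseudo_inverse_orth w : orthocomp (range f) w -> pseudo_inverse w = 0.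
Proof.
move=> ow; apply: pseudo_inverseE; first exact: orthocomp0.
by rewrite linear0 subr0.
Qed.

(** The difference of the two sides lies in the range and is orthogonal to it. *)
Lemma f_pseudo_inverseK v : f (pseudo_inverse (f v)) = f v.
Proof.
have [_ /(_ (f (v - pseudo_inverse (f v))))] := pseudo_inverseP (f v).
rewrite -linearB => /(_ _)/ip_eq0 h; apply/eqP; rewrite eq_sym -subr_eq0 -linearB.
by apply/eqP/h; exists (v - pseudo_inverse (f v)).
Qed.

End PseudoInverse.

(** * Filtration of the product by the index j, and finiteness of the series for G *)

Section Twisted.
Context {K : numFieldType} {theta : {rmorphism K -> K}}.
Context {N : nat} {Z : nat -> nat -> hilbertType theta}.
Variable d : forall i j, {linear Z i j -> Z i.+1 j}.
Variable S : forall i j, {linear Z i j.+1 -> Z i.+1 j}.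

Local Notation Y := (twY N Z).
Local Notation twd := (@twd _ _ N Z d).
Local Notation twS := (@twS _ _ N Z S).
Local Notation bggT := (@bggT _ _ N Z S).
Local Notation bggG := (@bggG _ _ N Z d S).

Lemma twcompE i (u : Y i) (j : 'I_N.+1) : twcomp u j = u j.
Proof.
case: j => j h /=; rewrite /twcomp; case: decP => [h'|//].
by rewrite (bool_irrelevance h' h).
Qed.

Lemma twcomp_out i (u : Y i) j : (N < j)%N -> twcomp u j = 0.
Proof. by rewrite /twcomp; case: decP => // h; rewrite ltnNge -ltnS h. Qed.

(** The condition [trunc m u = 0] is the m-th step of the filtration by j; truncation is an
    orthogonal projection that d respects and S shifts by one. *)
Definition trunc (m : nat) i (u : Y i) : Y i :=
  fun j => if (j < m)%N then u j else 0.

Lemma twcomp_trunc m i (u : Y i) j :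
  twcomp (trunc m u) j = if (j < m)%N then twcomp u j else 0.
Proof. by rewrite /twcomp /trunc; case: decP => // h; rewrite if_same. Qed.

Lemma truncB m i (u v : Y i) : trunc m (u - v) = trunc m u - trunc m v.
Proof.
apply/functional_extensionality_dep => j.
by rewrite /trunc; case: ifP => jm; rewrite [RHS]/GRing.add /= /hprod_add
  [in RHS]/GRing.opp /= /hprod_opp jm ?oppr0 ?addr0.
Qed.

Lemma twd_trunc m i (u : Y i) : twd (trunc m u) = trunc m (twd u).
Proof.
apply/functional_extensionality_dep => j; rewrite /Defs.twd /trunc.
by case: ifP => // _; rewrite linear0.
Qed.

Lemma twS_trunc m i (u : Y i) : twS (trunc m.+1 u) = trunc m (twS u).
Proof.
apply/functional_extensionality_dep => j.
rewrite /Defs.twS twcomp_trunc ltnS /trunc.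
by case: ifP => // _; rewrite linear0.
Qed.

Lemma ip_trunc m i (u v : Y i) : ip u (trunc m v) = ip (trunc m u) (trunc m v).
Proof.
rewrite /ip /= /inner /= /hprod_ip; apply: eq_bigr => j _.
by rewrite /trunc; case: ifP => // _; rewrite /ip !linear0.
Qed.

Lemma trunc_full i (u : Y i) : trunc N.+1 u = u.
Proof.
by apply/functional_extensionality_dep => j; rewrite /trunc ltn_ord.
Qed.

Hypothesis ker_projectable : forall i, projectable (kerS (N := N) S (i := i)).
Hypothesis range_projectable : forall i, projectable (range (@twS i)).

Lemma bggTP i (u : Y i.+1) : orthocomp (kerS S (i := i)) (bggT u) /\
  orthocomp (range (@twS i)) (u - twS (bggT u)).
Proof. exact: (pseudo_inverseP (@ker_projectable i) (@range_projectable i)). Qed.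

(* w := S T u is the projection of u onto ran S; since ran S is stable under
   truncation, the lowest m components of w vanish with those of u, and then
   the lowest m + 1 components of T u form an element of ker S. *)
Lemma trunc_bggT m i (u : Y i.+1) : trunc m u = 0 -> trunc m.+1 (bggT u) = 0.
Proof.
move=> u0; have [Tker Tran] := bggTP u; apply: ip_eq0.
rewrite -ip_trunc; apply: Tker; rewrite /kerS /= twS_trunc; apply: ip_eq0.
have : ip (u - twS (bggT u)) (trunc m (twS (bggT u))) = 0.
  by apply: Tran; rewrite -twS_trunc; eexists.
rewrite ip_trunc truncB u0 sub0r -scaleN1r ipZl mulN1r => /eqP.
by rewrite oppr_eq0 => /eqP.
Qed.

(** d preserves the filtration and each T gains one step; the innermost T accounts for the
    [k.+1]. *)
Lemma trunc_iter k i (u : Y i.+1) :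
  trunc k.+1 (iter k (@bggT i \o @twd i) (bggT u)) = 0.
Proof.
elim: k => [|k IH] /=; first exact: trunc_bggT.
by apply: trunc_bggT; rewrite -twd_trunc IH linear0.
Qed.

Lemma bggT_linear i : linear (@bggT i).
Proof.
exact: (pseudo_inverse_linear (@ker_projectable i) (@range_projectable i)).
Qed.

Definition linT i : {linear Y i.+1 -> Y i} := linear_of (@bggT_linear i).

Lemma bggT0 i : bggT (0 : Y i.+1) = 0.
Proof. exact: linear0 (linT i). Qed.

Lemma iter_bggT_eq0 k i (u : Y i.+1) : (N <= k)%N ->
  iter k (@bggT i \o @twd i) (bggT u) = 0.
Proof.
move=> /subnK <-; rewrite iterD.
have -> : iter N (@bggT i \o @twd i) (bggT u) = 0.
  by rewrite -[LHS]trunc_full trunc_iter.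
elim: (k - N)%N => //= n ->; by rewrite [twd 0]linear0 bggT0.
Qed.

(** The cutoff is left free so that the recursions below can compare sums of N + 1 and of N
    terms. *)
Lemma bggGE m i (u : Y i.+1) : (N <= m)%N ->
  bggG u = - \sum_(k < m) iter k (@bggT i \o @twd i) (bggT u).
Proof.
move=> Nm; rewrite fsbig_ord (fsbig_widen _ [set: nat])//.
move=> k [_ /negP]; rewrite -leqNgt => mk.
exact: iter_bggT_eq0 (leq_trans Nm mk).
Qed.

Lemma bggG_linear i : linear (@bggG i).
Proof.
have il k : linear (fun u => iter k (@bggT i \o @twd i) (bggT u)).
  elim: k => [|k IH] a u v /=; first exact: linearP (linT i) a u v.
  by rewrite IH [twd _]linearP; exact: linearP (linT i) a _ _.
move=> a u v; rewrite !(@bggGE N)// scalerN -opprD scaler_sumr -big_split /=.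
by congr (- _); apply: eq_bigr => k _; exact: il.
Qed.

Definition linG i : {linear Y i.+1 -> Y i} := linear_of (@bggG_linear i).

(** Splitting off the term k = 0 of the geometric series leaves T d G; in [bggG_GdT] the remaining
    terms are regrouped as (T d)^k T (d T). *)
Lemma bggG_TdG i (u : Y i.+1) : bggG u = bggT (twd (bggG u)) - bggT u.
Proof.
rewrite [LHS](@bggGE N.+1)// [in RHS](@bggGE N)// big_ord_recl /= opprD addrC; congr (_ - _).
pose Td : {linear Y i -> Y i} := linT i \o @twd i.
by rewrite -[RHS]/(Td _) [RHS]linearN [X in _ = - X]linear_sum.
Qed.

Lemma bggG_GdT i (u : Y i.+1) : bggG u = bggG (twd (bggT u)) - bggT u.
Proof.
rewrite [LHS](@bggGE N.+1)// [in RHS](@bggGE N)// big_ord_recl /= opprD addrC; congr (- _ - _).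
by apply: eq_bigr => k _; rewrite -iterSr.
Qed.

(** * Relations between S and T, and the projection onto Upsilon *)

Hypothesis SS : forall i j (z : Z i j.+2), S i.+1 j (S i j.+1 z) = 0.

Lemma twcomp_twS i (u : Y i) j : (j < N.+1)%N ->
  twcomp (twS u) j = S i j (twcomp u j.+1).
Proof. by move=> jN; rewrite (twcompE _ (Ordinal jN)). Qed.

Lemma twS_twS i (u : Y i) : twS (twS u) = 0.
Proof.
apply/functional_extensionality_dep => j; rewrite /Defs.twS.
have [jN|jN] := ltnP j.+1 N.+1; last by rewrite twcomp_out// linear0.
by rewrite twcomp_twS// SS.
Qed.

Lemma ran_prevS_ker i (u : Y i) : ran_prevS S u -> twS u = 0.
Proof.
by case: i u => [|i] u /=; [move->; rewrite linear0 | case=> v _ <-; exact: twS_twS].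
Qed.

(** T u is orthogonal to ker S, which contains ran S because S S = 0, and T vanishes on the
    orthogonal complement of ran S. *)
Lemma bggT_bggT i (u : Y i.+2) : bggT (bggT u) = 0.
Proof.
apply: pseudo_inverse_orth => //; have [Tker _] := bggTP u.
by move=> _ [v _ <-]; apply: Tker; exact: twS_twS.
Qed.

Lemma bggTST i (u : Y i.+1) : bggT (twS (bggT u)) = bggT u.
Proof. exact: (pseudo_inverseK (@ker_projectable i) (@range_projectable i)). Qed.

Lemma twSTS i (u : Y i) : twS (bggT (twS u)) = twS u.
Proof. exact: (f_pseudo_inverseK (@ker_projectable i) (@range_projectable i)). Qed.

Lemma upsilonP i (u : Y i) :
  u \in in_upsilon S (i := i) <-> twS u = 0 /\ orthocomp (ran_prevS S (i := i)) u.
Proof. by rewrite /in_upsilon in_setE. Qed.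

Lemma bggT_upsilon i (u : upsilon N S i.+1) : bggT (val u) = 0.
Proof.
have [_ ou] := (upsilonP (val u)).1 (valP u).
exact: pseudo_inverse_orth.
Qed.

Lemma twS_upsilon i (u : upsilon N S i) : twS (val u) = 0.
Proof. by have [] := (upsilonP (val u)).1 (valP u). Qed.

(** S T projects onto ran S and T S onto the orthogonal complement of ker S; as ran S lies in ker S,
    removing both leaves the projection onto Upsilon. In degree 0 the term S T is zero, as is
    [ran_prevS]. *)
Lemma val_upsilon_proj i (u : Y i) :
  val (upsilon_proj S u) = u - prev_comp (@twS) (@bggT) u - bggT (twS u).
Proof.
have [Tker _] := bggTP (twS u).
set p := prev_comp _ _ _.
have pP : ran_prevS S p /\ orthocomp (ran_prevS S (i := i)) (u - p).
  rewrite /p; case: i u {Tker p} => [|i] u /=.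
    by split=> // _ ->; rewrite /ip linear0r.
  by split; [exists (bggT u) | have [] := bggTP u].
have [pran pu] := pP.
have yU : u - p - bggT (twS u) \in in_upsilon S (i := i).
  apply/upsilonP; split.
    by rewrite !linearB /= twSTS (ran_prevS_ker pran) subr0 subrr.
  move=> w wran; rewrite ipBl pu// sub0r Tker ?oppr0//.
  exact: ran_prevS_ker.
rewrite /upsilon_proj (orthprojE (y := u - p - bggT (twS u))).
- by rewrite val_insubd yU.
- apply: submoduleI; last exact: submodule_orthocomp.
  exact: (submodule_ker (@twS i)).
- by move/upsilonP: yU.
- move=> w [wker wran]; rewrite opprD opprK opprB addrA addrC.
  rewrite [u + _]addrCA subrr addr0 ipDl Tker//.
  by rewrite (ip_eq0C (wran p _)) ?addr0.
Qed.

Lemma upsilon_projK i (u : upsilon N S i) : upsilon_proj S (val u) = u.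
Proof.
apply: val_inj; rewrite val_upsilon_proj twS_upsilon.
rewrite bggT0 subr0 (_ : prev_comp _ _ _ = 0) ?subr0//.
by case: i u => [|i] u //=; rewrite bggT_upsilon linear0.
Qed.

Lemma prev_comp_linear (X : nat -> lmodType K) (D : forall i, {linear X i -> X i.+1})
  (P : forall i, {linear X i.+1 -> X i}) i : linear (prev_comp D P (i := i)).
Proof.
by case: i => [|i] a x y /=; rewrite ?scaler0 ?addr0// !linearP.
Qed.

Definition linS i : {linear Y i -> Y i.+1} := @twS i.

Definition lind i : {linear Y i -> Y i.+1} := @twd i.

Lemma upsilon_proj_linear i : linear (@upsilon_proj _ _ N Z S i).
Proof.
move=> a u v; apply: val_inj; rewrite linearP /= !val_upsilon_proj.
have pl := prev_comp_linear linS linT a u v.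
rewrite -[prev_comp _ _ _]/(prev_comp linS linT _) pl.
have -> : bggT (twS (a *: u + v)) = a *: bggT (twS u) + bggT (twS v).
  by rewrite linearP; exact: linearP (linT i) _ _ _.
by do 2![rewrite opprD addrACA -scalerBr].
Qed.

Definition linproj i : {linear Y i -> upsilon N S i} := linear_of (@upsilon_proj_linear i).

(** * The twisted differential, and linearity of the BGG maps *)

Local Notation twdV := (twdV N d S _).

Lemma twdV_linear i : linear (@Defs.twdV _ _ N Z d S i).
Proof.
move=> a u v; rewrite /Defs.twdV [twd _]linearP [twS _]linearP.
by rewrite opprD addrACA -scalerBr.
Qed.

Definition lindV i : {linear Y i -> Y i.+1} := linear_of (@twdV_linear i).

Hypothesis dd : forall i j (z : Z i j), d i.+1 j (d i j z) = 0.
Hypothesis dS :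
  forall i j (z : Z i j.+1), d i.+1 j (S i j z) = - S i.+1 j (d i j.+1 z).

Lemma twd_twd i (u : Y i) : twd (twd u) = 0.
Proof. by apply/functional_extensionality_dep => j; exact: dd. Qed.

Lemma twcomp_twd i (u : Y i) j : twcomp (twd u) j = d i j (twcomp u j).
Proof. by rewrite /twcomp; case: decP => // _; rewrite linear0. Qed.

Lemma twd_twS i (u : Y i) : twd (twS u) = - twS (twd u).
Proof.
apply/functional_extensionality_dep => j.
by rewrite /Defs.twd dS -twcomp_twd.
Qed.

Lemma twdV_twdV i (u : Y i) : twdV (twdV u) = 0.
Proof.
rewrite /Defs.twdV [twd (_ - _)]linearB [twS (_ - _)]linearB /=.
by rewrite twd_twd twS_twS twd_twS opprK add0r subr0 subrr.
Qed.

Lemma bggA_linear i : linear (@bggA _ _ N Z d S i).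
Proof.
move=> a u v; rewrite /bggA.
have -> : val (a *: u + v) = a *: val u + val v by exact: linearP.
rewrite [bggG _](linearP (linG i \o lindV i) a (val u) (val v)).
by rewrite opprD addrACA -scalerBr.
Qed.

Definition linA i : {linear upsilon N S i -> Y i} := linear_of (@bggA_linear i).

Lemma bggB_linear i : linear (@bggB _ _ N Z d S i).
Proof.
move=> a u v; rewrite /bggB.
rewrite -[prev_comp _ _ _]/(prev_comp lindV linG _) (prev_comp_linear lindV linG).
rewrite opprD addrACA -scalerBr; exact: linearP (linproj i) _ _ _.
Qed.

Definition linB i : {linear Y i -> upsilon N S i} := linear_of (@bggB_linear i).

Lemma bggD_linear i : linear (@bggD _ _ N Z d S i).
Proof. exact: linearP (linproj i.+1 \o lindV i \o linA i). Qed.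

Definition linD i : {linear upsilon N S i -> upsilon N S i.+1} :=
  linear_of (@bggD_linear i).

End Twisted.

(** * Projections onto the kernel and the range of S on the product *)

Section TwistedProjectable.
Context {K : numFieldType} {theta : {rmorphism K -> K}}.
Context {N : nat} {Z : nat -> nat -> hilbertType theta}.
Variable S : forall i j, {linear Z i j.+1 -> Z i.+1 j}.
Hypothesis K_inf : has_nneg_inf K.
Hypothesis S_bounded : forall i j, bounded_op (S i j).
Hypothesis S_closed : forall i j, closed (range (S i j)).

Lemma ip_twY i (u v : twY N Z i) : ip u v = \sum_j ip (u j) (v j).
Proof. by []. Qed.

(** The kernel is a product, with all of [Z i 0] in component 0 and the closed kernel of [S i j] in
    component j + 1, so one projects factor by factor. *)
Lemma twS_ker_projectable i : projectable (kerS (N := N) S (i := i)).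
Proof.
move=> u.
pose k j := orthproj [set z | S i j z = 0] (twcomp u j.+1).
have kP j : S i j (k j) = 0 /\ orthocomp [set z | S i j z = 0] (twcomp u j.+1 - k j).
  apply: orthprojP; apply: closed_projectable K_inf (submodule_ker (S i j)) _.
  exact: closed_kernel (S_bounded i j).
pose k' j : Z i j := if j is j'.+1 then k j' else twcomp u 0.
pose p : twY N Z i := fun j => k' j.
exists p.
  apply/functional_extensionality_dep => j; rewrite /twS /twcomp.
  by case: decP => [h|_] /=; [have [] := kP j | rewrite linear0].
move=> v vker; rewrite ip_twY big1// => j _.
have -> : (u - p) j = twcomp u j - k' j.
  by rewrite twcompE.
rewrite -twcompE; case: j => -[|j] jN /=; first by rewrite subrr /ip linear0l.
have [_] := kP j; apply => /=.
have := congr1 (fun w : twY N Z i.+1 => w (Ordinal (ltnW jN))) vker.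
by rewrite /twS.
Qed.

(** The pseudo-inverses of the [S i j] give preimages of the componentwise projections; shifted by
    one index, they assemble into a single [v]. *)
Lemma twS_range_projectable i : projectable (range (@twS _ _ N Z S i)).
Proof.
move=> u.
pose x j := pseudo_inverse (S i j) (twcomp u j).
have xP j : orthocomp (range (S i j)) (twcomp u j - S i j (x j)).
  apply: (proj2 (pseudo_inverseP _ _ _)); apply: closed_projectable K_inf _ _.
  - exact: submodule_ker.
  - exact: closed_kernel.
  - exact: submodule_range.
  - exact: S_closed.
pose x' j : Z i j := if j is j'.+1 then x j' else 0.
pose v : twY N Z i := fun j => x' j.
exists (twS S v); first by exists v.
move=> _ [w _ <-]; rewrite ip_twY big1// => j _.
have -> : (u - twS S v) j = twcomp u j - S i j (twcomp v j.+1).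
  by rewrite twcompE.
(* For j = N the entry of [w] at N + 1 reads as 0, so elements of the range have zero top
   component. *)
rewrite /twS; have [jN|jN] := ltnP j.+1 N.+1; last first.
  by rewrite [twcomp w _]twcomp_out// linear0 /ip linear0r.
by rewrite [twcomp v _](twcompE _ (Ordinal jN)); apply: xP; eexists.
Qed.

End TwistedProjectable.

(** * Transfer of a homotopy relation along maps inverse up to homotopy *)

Section Transfer.
Context {K : numFieldType} {X U : nat -> lmodType K}.
Variables (D : forall i, {linear X i -> X i.+1}).
Variables (G : forall i, {linear X i.+1 -> X i}).
Variables (A : forall i, {linear U i -> X i}) (B : forall i, {linear X i -> U i}).
Variable DU : forall i, U i -> U i.+1.
Hypothesis DD : forall i (x : X i), D i.+1 (D i x) = 0.
Hypothesis BA : forall i (u : U i), B i (A i u) = u.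
Hypothesis AB :
  forall i (x : X i), A i (B i x) = x - prev_comp D G x - G i (D i x).
Hypothesis DUE : forall i (u : U i), DU u = B i.+1 (D i (A i u)).

Lemma diff_prev_comp i (x : X i) : D i (prev_comp D G x) = 0.
Proof. by case: i x => [|i] x /=; rewrite ?linear0 ?DD. Qed.

(** The defect of the chain map property is D G D A, and applying D to A B A = A shows that it
    vanishes. *)
Lemma transfer_chainA i (u : U i) : A i.+1 (DU u) = D i (A i u).
Proof.
rewrite DUE AB /= DD linear0 subr0.
have := congr1 (D i) (AB (A i u)).
rewrite BA !linearB /= diff_prev_comp subr0 => /eqP.
by rewrite -subr_eq0 opprB addrC subrK => /eqP->; rewrite subr0.
Qed.

(** Dually, the defect is B D G D, and B A B D = B D shows that it vanishes. *)
Lemma transfer_chainB i (x : X i) : DU (B i x) = B i.+1 (D i x).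
Proof.
rewrite DUE AB !linearB /= diff_prev_comp linear0 subr0.
have := BA (B i.+1 (D i x)); rewrite AB /= DD linear0 subr0 linearB /=.
by move=> ->.
Qed.

Variables (P : forall i, {linear X i.+1 -> X i}).
Variables (L : forall i, {linear X i -> X i}).
Hypothesis DPL : homotopy D P L.
Hypothesis DL : forall i x, D i (L i x) = 0.
Hypothesis LD : forall i x, L i.+1 (D i x) = 0.

Definition transferL i : {linear U i -> U i} := B i \o L i \o A i.

Lemma transfer_homotopy :
  homotopy DU (fun i u => B i (P i (A i.+1 u))) transferL.
Proof.
move=> i u; rewrite /= transfer_chainA -[in RHS](BA u).
rewrite BA -[X in _ = X - _]BA -linearB /= -DPL linearD /=; congr (_ + _).
by case: i u => [|i] u /=; rewrite ?linear0// transfer_chainB.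
Qed.

Lemma transferL_diff i (u : U i) : transferL i.+1 (DU u) = 0.
Proof. by rewrite /= transfer_chainA LD linear0. Qed.

Lemma diff_transferL i (u : U i) : DU (transferL i u) = 0.
Proof. by rewrite /= transfer_chainB DL linear0. Qed.

(** Between two factors L, the terms D G and G D of A B are killed by L D = 0 and D L = 0. *)
Lemma transferL_idem : (forall i x, L i (L i x) = L i x) ->
  forall i (u : U i), transferL i (transferL i u) = transferL i u.
Proof.
move=> LL i u; rewrite /= AB DL linear0 subr0 linearB /= LL.
rewrite (_ : L i (prev_comp _ _ _) = 0) ?subr0//.
by case: i u => [|i] u /=; rewrite ?linear0// LD.
Qed.

End Transfer.

(** * Idempotence of L, and the passage from P to P D P *)

Section ComplexProperty.
Context {K : numFieldType} {X : nat -> lmodType K}.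
Variables (D : forall i, {linear X i -> X i.+1}).
Variables (P : forall i, {linear X i.+1 -> X i}).
Variables (L : forall i, {linear X i -> X i}).
Hypothesis DD : forall i x, D i.+1 (D i x) = 0.
Hypothesis DPL : homotopy D P L.
Hypothesis DL : forall i x, D i (L i x) = 0.
Hypothesis LD : forall i x, L i.+1 (D i x) = 0.

Lemma homotopyS i (x : X i.+1) :
  D i (P i x) = x - L i.+1 x - P i.+1 (D i.+1 x).
Proof. by rewrite -DPL /= addrK. Qed.

(** P P = 0 makes P commute with L, as P L and L P both equal P - P D P. With D L = 0, both
    corrections in L L = L - D P L - P D L then vanish. *)
Lemma homotopy_idem : (forall i x, P i (P i.+1 x) = 0) ->
  forall i x, L i (L i x) = L i x.
Proof.
move=> PP i x; have E (y : X i) : L i y = y - prev_comp D P y - P i (D i y).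
  by rewrite -addrA -opprD DPL subKr.
rewrite [LHS]E DL [P i 0]linear0 subr0 (_ : prev_comp _ _ _ = 0) ?subr0//.
case: i x {E} => [|i] x //=.
have -> : P i (L i.+1 x) = L i (P i x); last by rewrite DL.
have -> : L i.+1 x = x - D i (P i x) - P i.+1 (D i.+1 x).
  by rewrite -addrA -opprD DPL subKr.
have -> : L i (P i x) = P i x - prev_comp D P (P i x) - P i (D i (P i x)).
  by rewrite -addrA -opprD DPL subKr.
rewrite !linearB /= PP subr0 (_ : prev_comp _ _ _ = 0) ?subr0//.
by case: i x => [|i] x //=; rewrite PP linear0.
Qed.

Lemma diff_homotopyK i (x : X i) : D i (P i (D i x)) = D i x.
Proof. by rewrite homotopyS LD DD [P _ 0]linear0 !subr0. Qed.

Definition complexP i : {linear X i.+1 -> X i} := P i \o D i \o P i.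

(** Since D P D = D, the products D P and P D do not change when P becomes P D P, so L stays the
    same. *)
Lemma complexP_homotopy : homotopy D complexP L.
Proof.
move=> i x; rewrite -DPL /= diff_homotopyK; congr (_ + _).
by case: i x => [|i] x //=; rewrite diff_homotopyK.
Qed.

(* D P P D = (1 - L - P D) P D = - L P D = - L (1 - L - D P) = 0 *)
Lemma complexP_complex : (forall i x, L i (L i x) = L i x) ->
  forall i x, complexP i (complexP i.+1 x) = 0.
Proof.
move=> LL i x /=; rewrite homotopyS diff_homotopyK.
set y := P i.+1 x.
have -> : P i.+1 (D i.+1 y) = y - L i.+1 y - D i (P i y).
  by rewrite homotopyS opprB addrC subrK.
rewrite [L i.+1 (_ - _)]linearB /= [L i.+1 (_ - _)]linearB /= LL LD subrr.
by rewrite !subr0 subrr linear0.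
Qed.

End ComplexProperty.

(** * Operator identities behind B A = 1 and A B = 1 - d_V G - G d_V *)

Section BGGAlgebra.
Context {K : numFieldType} {Y U : nat -> lmodType K}.
Variables (d S dV : forall i, {linear Y i -> Y i.+1}).
Variables (T G : forall i, {linear Y i.+1 -> Y i}).
Variables (incl : forall i, {linear U i -> Y i}).
Variables (proj : forall i, {linear Y i -> U i}).
Hypothesis dVE : forall i y, dV i y = d i y - S i y.
Hypothesis dVdV : forall i y, dV i.+1 (dV i y) = 0.
Hypothesis TT : forall i y, T i (T i.+1 y) = 0.
Hypothesis TST : forall i y, T i (S i (T i y)) = T i y.
(* G = - sum_k (T d)^k T enters only through these two recursions. *)
Hypothesis GTd : forall i y, G i y = T i (d i (G i y)) - T i y.
Hypothesis GdT : forall i y, G i y = G i (d i (T i y)) - T i y.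
Hypothesis T_incl : forall i u, T i (incl i.+1 u) = 0.
Hypothesis projK : forall i u, proj i (incl i u) = u.
Hypothesis inclK :
  forall i y, incl i (proj i y) = y - prev_comp S T y - T i (S i y).

Lemma TG i y : T i (G i.+1 y) = 0.
Proof. by rewrite GTd linearB /= !TT subrr. Qed.

Lemma TSG i y : T i (S i (G i y)) = G i y.
Proof. by rewrite [G i y]GTd !linearB /= !TST. Qed.

Lemma GG i y : G i (G i.+1 y) = 0.
Proof. by rewrite GdT TG linear0 [G i 0]linear0 subr0. Qed.

(** T S G = G turns the second recursion, applied to S G, into G S G = G d G - G. *)
Lemma GdVG i y : G i (dV i (G i y)) = G i y.
Proof.
have GSG : G i (S i (G i y)) = G i (d i (G i y)) - G i y.
  by rewrite [LHS]GdT TSG.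
by rewrite dVE linearB /= GSG subKr.
Qed.

(* An idempotent cochain map, with A = hproj incl and B = proj hproj. *)
Definition hproj i (y : Y i) : Y i := y - prev_comp dV G y - G i (dV i y).

Lemma hprojB i : {morph @hproj i : x y / x - y}.
Proof.
have pB : {morph prev_comp dV G (i := i) : x y / x - y}.
  by case: i => [|i] x y /=; rewrite ?subrr// !linearB.
have GB : {morph (fun y => G i (dV i y)) : x y / x - y}.
  by move=> x y /=; rewrite !linearB.
move=> x y; rewrite /hproj pB GB !opprD !opprK [RHS]addrACA.
by congr (_ + _); rewrite [RHS]addrACA.
Qed.

Lemma dV_hproj i (y : Y i) : dV i (hproj y) = dV i y - dV i (G i (dV i y)).
Proof. by rewrite /hproj !linearB /= diff_prev_comp// subr0. Qed.

Lemma hproj_dV i (y : Y i) : hproj (dV i y) = dV i (hproj y).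
Proof. by rewrite dV_hproj /hproj /= dVdV linear0 subr0. Qed.

Lemma G_hproj i (y : Y i.+1) : G i (hproj y) = 0.
Proof. by rewrite /hproj !linearB /= GG subr0 GdVG subrr. Qed.

Lemma hproj_G i (y : Y i.+1) : hproj (G i y) = 0.
Proof.
rewrite /hproj GdVG (_ : prev_comp _ _ _ = 0) ?subr0 ?subrr//.
by case: i y => [|i] y //=; rewrite GG linear0.
Qed.

(** T = T d G - G, so T vanishes wherever G does. Dually, T = G d T - G reduces [hproj_T] to
    [hproj_G]. *)
Lemma T_hproj i (y : Y i.+1) : T i (hproj y) = 0.
Proof.
have := GTd (hproj y); rewrite G_hproj linear0 [T i 0]linear0 sub0r => /eqP.
by rewrite eq_sym oppr_eq0 => /eqP.
Qed.

Lemma hproj_T i (y : Y i.+1) : hproj (T i y) = 0.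
Proof.
have -> : T i y = G i (d i (T i y)) - G i y by rewrite [G i y]GdT subKr.
by rewrite hprojB !hproj_G subrr.
Qed.

Lemma hproj_idem i (y : Y i) : hproj (hproj y) = hproj y.
Proof.
rewrite {1}/hproj dV_hproj linearB /= GdVG subrr subr0.
rewrite (_ : prev_comp _ _ _ = 0) ?subr0//.
by case: i y => [|i] y //=; rewrite G_hproj linear0.
Qed.

Lemma hproj_inclK i (y : Y i) : hproj (incl i (proj i (hproj y))) = hproj y.
Proof.
rewrite inclK hprojB hproj_T subr0 (_ : prev_comp _ _ _ = 0).
  by rewrite subr0 hproj_idem.
by case: i y => [|i] y //=; rewrite T_hproj linear0.
Qed.

(** In Pi G = G - S T G - T S G one has T G = 0 and T S G = G. *)
Lemma proj_G i (y : Y i.+1) : proj i (G i y) = 0.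
Proof.
rewrite -[LHS]projK inclK TSG (_ : prev_comp _ _ _ = 0) ?subr0 ?subrr ?linear0//.
by case: i y => [|i] y //=; rewrite TG linear0.
Qed.

Lemma proj_hproj i (y : Y i) : proj i (hproj y) = proj i (y - prev_comp dV G y).
Proof. by rewrite /hproj [LHS]linearB /= proj_G subr0. Qed.

(** G = G d T - T vanishes on Upsilon because T does, which removes the term d_V G. *)
Lemma hproj_incl i (u : U i) :
  hproj (incl i u) = incl i u - G i (dV i (incl i u)).
Proof.
rewrite /hproj (_ : prev_comp _ _ _ = 0) ?subr0//.
by case: i u => [|i] u //=; rewrite GdT T_incl linear0 [G i 0]linear0 subr0 linear0.
Qed.

Variables (A : forall i, {linear U i -> Y i}) (B : forall i, {linear Y i -> U i}).
Hypothesis AE : forall i u, A i u = incl i u - G i (dV i (incl i u)).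
Hypothesis BE : forall i y, B i y = proj i (y - prev_comp dV G y).

Lemma bgg_BA i u : B i (A i u) = u.
Proof.
by rewrite BE -proj_hproj AE -hproj_incl hproj_idem hproj_incl linearB /= proj_G
  subr0 projK.
Qed.

Lemma bgg_AB i y : A i (B i y) = y - prev_comp dV G y - G i (dV i y).
Proof. by rewrite BE -proj_hproj AE -hproj_incl hproj_inclK. Qed.

(** Q commutes with d_V and fixes the image of A. This brings the definition of the BGG differential
    into the form B d_V A used in the transfer. *)
Lemma bgg_proj_diff i u : proj i.+1 (dV i (A i u)) = B i.+1 (dV i (A i u)).
Proof.
by rewrite BE -proj_hproj hproj_dV AE -hproj_incl hproj_idem.
Qed.

End BGGAlgebra.

(** * The transfer statement for abstract complexes *)

Section TransferTheorem.
Context {K : numFieldType} {X U : nat -> lmodType K}.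
Variables (D : forall i, {linear X i -> X i.+1}).
Variables (G : forall i, {linear X i.+1 -> X i}).
Variables (A : forall i, {linear U i -> X i}) (B : forall i, {linear X i -> U i}).
Variable DU : forall i, {linear U i -> U i.+1}.
Variables (P : forall i, {linear X i.+1 -> X i}).
Variables (L : forall i, {linear X i -> X i}).
Hypothesis DD : forall i (x : X i), D i.+1 (D i x) = 0.
Hypothesis BA : forall i (u : U i), B i (A i u) = u.
Hypothesis AB :
  forall i (x : X i), A i (B i x) = x - prev_comp D G x - G i (D i x).
Hypothesis DUE : forall i (u : U i), DU i u = B i.+1 (D i (A i u)).
Hypothesis DPL : homotopy D P L.
Hypothesis DL : forall i x, D i (L i x) = 0.
Hypothesis LD : forall i x, L i.+1 (D i x) = 0.

(** One [LU] serves both the transferred homotopy and its modification, since passing to P D P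
    leaves L unchanged. *)
Theorem homotopy_transfer : exists LU : forall i, {linear U i -> U i},
  [/\ homotopy DU (fun i u => B i (P i (A i.+1 u))) LU,
      forall i u, LU i.+1 (DU i u) = 0,
      forall i u, DU i (LU i u) = 0,
      (forall i x, L i (L i x) = L i x) -> forall i u, LU i (LU i u) = LU i u
    & (forall i x, P i (P i.+1 x) = 0) ->
      [/\ forall i x, L i (L i x) = L i x,
          forall i u, LU i (LU i u) = LU i u
        & exists P' : forall i, {linear U i.+1 -> U i},
            homotopy DU P' LU /\ forall i u, P' i (P' i.+1 u) = 0]].
Proof.
have homP := transfer_homotopy DD BA AB DUE DPL.
have LDU := transferL_diff DD BA AB DUE LD.
have LLU := transferL_idem AB DL LD.
exists (transferL A B L); split=> //.
- exact: (diff_transferL DD BA AB DUE DL).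
move=> PP; have LL := homotopy_idem DPL DL PP.
pose PU i : {linear U i.+1 -> U i} := B i \o P i \o A i.+1.
have DUDU i u : DU i.+1 (DU i u) = 0.
  by rewrite [DU i u]DUE (transfer_chainB DD BA AB DUE) DD linear0.
have homPU : homotopy DU PU (transferL A B L) := homP.
split=> //; first exact: LLU.
exists (complexP DU PU); split.
  exact: (complexP_homotopy DUDU homPU LDU).
exact: (complexP_complex DUDU homPU LDU (LLU LL)).
Qed.

End TransferTheorem.

(** * Application to the twisted and BGG complexes *)

Theorem theorem6 (R : realType) (c : scalar_kind) (n N : nat)
  (Z : nat -> nat -> hilbertType (scalar_conj R c))
  (hZ : forall i j, (n < i)%N || (N < j)%N -> forall z : Z i j, z = 0)
  (d : forall i j, {linear Z i j -> Z i.+1 j})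
  (S : forall i j, {linear Z i j.+1 -> Z i.+1 j})
  (hd_bounded : forall i j, bounded_op (d i j))
  (hS_bounded : forall i j, bounded_op (S i j))
  (hS_closed : forall i j, closed (range (S i j)))
  (hdd : forall i j (z : Z i j), d i.+1 j (d i j z) = 0)
  (hdS : forall i j (z : Z i j.+1), d i.+1 j (S i j z) = - S i.+1 j (d i j.+1 z))
  (hSS : forall i j (z : Z i j.+2), S i.+1 j (S i j.+1 z) = 0)
  (PV : forall i, {linear twY N Z i.+1 -> twY N Z i})
  (LV : forall i, {linear twY N Z i -> twY N Z i})
  (hPV : homotopy (twdV N d S) PV LV)
  (hdL : forall i (y : twY N Z i), twdV N d S i (LV i y) = 0)
  (hLd : forall i (y : twY N Z i), LV i.+1 (twdV N d S i y) = 0) :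
  exists L : forall i, {linear upsilon N S i -> upsilon N S i},
    [/\ homotopy (bggD N d S) (bggP N d S PV) L,
        forall i (u : upsilon N S i), L i.+1 (bggD N d S i u) = 0,
        forall i (u : upsilon N S i), bggD N d S i (L i u) = 0,
        (forall i (y : twY N Z i), LV i (LV i y) = LV i y) ->
          forall i (u : upsilon N S i), L i (L i u) = L i u
      & (forall i (y : twY N Z i.+2), PV i (PV i.+1 y) = 0) ->
        [/\ forall i (y : twY N Z i), LV i (LV i y) = LV i y,
            forall i (u : upsilon N S i), L i (L i u) = L i u
          & exists P' : forall i,
                {linear upsilon N S i.+1 -> upsilon N S i},
              homotopy (bggD N d S) P' L /\
              forall i (u : upsilon N S i.+2), P' i (P' i.+1 u) = 0]].
Proof.
(* Completeness of the real numbers enters here, through the existence of projections. *)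
have Kinf := @scalars_nneg_inf R c.
have kp := @twS_ker_projectable _ _ N Z S Kinf hS_bounded.
have rp := @twS_range_projectable _ _ N Z S Kinf hS_bounded hS_closed.
pose S' := @linS _ _ N Z S; pose d' := @lind _ _ N Z d.
pose dV := @lindV _ _ N Z d S.
pose T := linT kp rp; pose G := linG d kp rp.
pose A := linA d kp rp; pose B := linB d kp rp hSS.
pose incl i : {linear upsilon N S i -> twY N Z i} := \val.
pose proj := linproj kp rp hSS; pose DU := linD d kp rp hSS.
have dVdV : forall i u, dV i.+1 (dV i u) = 0 := twdV_twdV hSS hdd hdS.
have dVE i u : dV i u = d' i u - S' i u by [].
have TT i u : T i (T i.+1 u) = 0 := bggT_bggT kp rp hSS u.
have TST i u : T i (S' i (T i u)) = T i u := bggTST kp rp u.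
have GTd i u : G i u = T i (d' i (G i u)) - T i u := bggG_TdG d kp rp u.
have GdT i u : G i u = G i (d' i (T i u)) - T i u := bggG_GdT d kp rp u.
have T_incl i u : T i (incl i.+1 u) = 0 := bggT_upsilon u.
have projK i u : proj i (incl i u) = u := upsilon_projK kp rp hSS u.
have inclK i u :
    incl i (proj i u) = u - prev_comp S' T u - T i (S' i u).
  exact: (val_upsilon_proj kp rp hSS).
have AE i u : A i u = incl i u - G i (dV i (incl i u)) by [].
have BE i u : B i u = proj i (u - prev_comp dV G u) by [].
have BA i u : B i (A i u) = u.
  exact: (bgg_BA dVE dVdV TT TST GTd GdT T_incl projK inclK AE BE).
have AB i x : A i (B i x) = x - prev_comp dV G x - G i (dV i x).
  exact: (bgg_AB dVE dVdV TT TST GTd GdT T_incl projK inclK AE BE).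
have DE i u : DU i u = B i.+1 (dV i (A i u)).
  exact: (bgg_proj_diff dVE dVdV TT TST GTd GdT T_incl projK inclK AE BE).
(* [DU] and the transferred operator unfold to [bggD] and [bggP]. *)
exact: (homotopy_transfer dVdV BA AB DE hPV hdL hLd).
Qed.
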